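(* Let $G$ be a finite stage-game, let $\delta\in(0,1)$, let $\mathbf a^\ast=(a^\ast_1,a^\ast_2,\ldots)\in\mathcal A^\ast$, and let $(\varepsilon^i)_{i\in N}$ be positive numbers such that for every $i\in N$ and every $t\ge 1$ $$\sum_{\tau=t}^{\infty}\delta^{\tau-t}r^{i,\mathrm{coop}}_\tau\;\ge\;\max\{r^{i,\mathrm{coop}}_t,r^{i,\mathrm{dfct}}_t\}+\sum_{\tau=t+1}^{\infty}\delta^{\tau-t}r^{i,\mathrm{NE}}+\varepsilon^i,$$ where the payoffs $r^{i,\mathrm{coop}}_t,r^{i,\mathrm{dfct}}_t$ are those of the sequence $\mathbf a^\ast$. Then there is a finite threshold $T^\ast$, depending only on the stage-game $G$, the discount factor $\delta$ and the margins $(\varepsilon^i)_{i\in N}$, such that for every horizon $T\ge T^\ast$ there exist a deposit scheme $d=(d^i_t)_{i\in N,\,t\in[T]}$ and a terminal-payoff rule $w=(w^i)_{i\in N}$ for which the strategy profile $(\tilde\sigma,\tilde\rho)$ (the truncation to horizon $T$ of the target $\mathbf a^\ast$ with Nash threats) is a subgame perfect equilibrium of $G^T_\delta(d,w)$.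
   Context: **Stage-game.** $G=(N,\{A^i\}_{i\in N},\{r^i\}_{i\in N})$, where $N$ is a finite set of players (with a fixed ordering of indices), $A^i$ is a finite (nonempty) set of actions of player $i$, $A=\prod_{i\in N}A^i$, and $r^i:A\to\mathbb R$ is player $i$'s stage payoff. $\Delta(A^i)$ is the set of mixed actions of player $i$, $\Delta=\prod_i\Delta(A^i)$, and $r^i$ is extended multilinearly to $\Delta$ (expected payoff under independent randomisation). $\mathcal N(G)\subseteq\Delta$ is the set of (mixed) Nash equilibria of $G$, $r^{i,\mathrm{NE}}:=\min_{\alpha\in\mathcal N(G)}r^i(\alpha)$, and $\alpha^{\mathrm{pun}}(i)\in\operatorname{arg\,min}_{\alpha\in\mathcal N(G)}r^i(\alpha)$ is a fixed minimiser for each $i$; $\alpha^{\mathrm{pun},j}(i)$ denotes its $j$-th component. **The class $\mathcal A^\ast$.** For an infinite sequence $\mathbf a=(a_1,a_2,\ldots)$ of pure action profiles $a_t\in A$, put $r^{i,\mathrm{coop}}_t=r^i(a_t)$ and $r^{i,\mathrm{dfct}}_t=\max_{a^i\in A^i\setminus\{a^i_t\}}r^i(a^i,a_t^{-i})$ (with the convention $\max\varnothing=-\infty$). $\mathcal A^\ast$ is the set of sequences $\mathbf a$ such that for every $i\in N$ there is $\varepsilon^i>0$ such that for all $t\ge1$ $$\sum_{\tau=t}^{\infty}\delta^{\tau-t}r^{i,\mathrm{coop}}_\tau\ge\max\{r^{i,\mathrm{coop}}_t,r^{i,\mathrm{dfct}}_t\}+\sum_{\tau=t+1}^{\infty}\delta^{\tau-t}r^{i,\mathrm{NE}}+\varepsilon^i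 .$$ **The augmented game $G^T_\delta(d,w)$.** The horizon is $T$, $[T]=\{1,\dots,T\}$, and the deposit scheme $d=(d^i_t)_{i\in N,t\in[T]}$ consists of fixed non-negative reals. In each period $t\in[T]$: all players simultaneously choose actions $a^i_t\in A^i$; the action profile $a_t$ is observed by all and player $i$ gets $r^i(a_t)$; then the players simultaneously decide whether to pay the deposit $d^i_t$ ($p^i_t=1$) or not ($p^i_t=0$), and $p_t=(p_t^i)_{i\in N}$ is observed by all. $H_t=(A\times\{0,1\}^N)^t$ is the set of histories of length $t$ ($H_0$ contains only the empty history). A terminal-payoff rule is $w=(w^i)_{i\in N}$ with $w^i:H_T\to\mathbb R_{\ge0}$ satisfying the feasibility condition: for every $h_T=(a_t,p_t)_{t=1}^T\in H_T$ and every $i$, $w^i(h_T)\le\sum_{t=1}^Tp^i_td^i_t$. The payoff of player $i$ is $$U^i(h_T)=\sum_{t=1}^T\delta^{t-1}\big(r^i(a_t)-p^i_td^i_t\big)+\delta^{T-1}w^i(h_T).$$ **Strategies and equilibrium.** A strategy of player $i$ is $(\sigma^i,\rho^i)=(\sigma^i_t,\rho^i_t)_{t\in[T]}$ with $\sigma^i_t:H_{t-1}\to\Delta(A^i)$ (action rule; players randomise independently) and $\rho^i_t:H_{t-1}\times A\to\{0,1\}$ (deposit rule). $\mathbb E_{(\sigma,\rho)|h}$ denotes expectation over terminal histories when the history $h$ has occurred and play then follows $(\sigma,\rho)$. A profile $(\sigma^*,\rho^* )$ is a subgame perfect equilibrium if for every $i\in N$, every strategy $(\sigma^i,\rho^i)$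 of player $i$ and every $h\in\bigcup_{t=0}^{T-1}H_t$, $\mathbb E_{(\sigma^*,\rho^* )|h}[U^i(h_T)]\ge\mathbb E_{(({\sigma^*}^{-i},{\rho^*}^{-i}),(\sigma^i,\rho^i))|h}[U^i(h_T)]$. **The profile $(\tilde\sigma,\tilde\rho)$.** Given $\mathbf a^\ast$, let $h^\ast_t\in H_t$ be the on-path history, in which every player plays $a^{\ast}_1,\dots,a^\ast_t$ and pays every deposit ($p^i_s=1$ for all $i$ and $s\le t$). For $h_t\ne h^\ast_t$, let $i(h_t)$ be the first player to deviate from the target actions or from the prescribed deposit payments (within a period the action stage precedes the deposit stage; simultaneous deviations are resolved in favour of the lowest index). Then, for every $t\in[T]$ and every player $j$: $\tilde\sigma^j_t(h_{t-1})=a^{\ast,j}_t$ if $h_{t-1}=h^\ast_{t-1}$ and $\tilde\sigma^j_t(h_{t-1})=\alpha^{\mathrm{pun},j}(i(h_{t-1}))$ otherwise; $\tilde\rho^j_t(h_{t-1},a_t)=1$ if $h_{t-1}=h^\ast_{t-1}$ and $a_t=a^\ast_t$, and $\tilde\rho^j_t(h_{t-1},a_t)=0$ otherwise. *)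

(* Defs.v *)
From HB Require Import structures.
From mathcomp Require Import all_boot all_order all_algebra.
From mathcomp Require Import all_classical all_reals all_analysis.

Set Implicit Arguments.
Unset Strict Implicit.
Unset Printing Implicit Defensive.

Import Order.TTheory GRing.Theory Num.Theory.
Import numFieldNormedType.Exports.

Local Open Scope classical_set_scope.
Local Open Scope ring_scope.

(* Time is 0-based throughout: index t : nat stands for period t + 1, so the
   discount factor of the t-th period is delta ^+ t. *)

Section Mixed.
Variables (R : realType) (T : finType).

Record mixed := Mixed {
  mixed_val :> {ffun T -> R};
  _ : [forall x, 0 <= mixed_val x] && (\sum_x mixed_val x == 1) }.

HB.instance Definition _ := [isSub for mixed_val].

Lemma pure_subproof (x : T) (f := [ffun y => (y == x)%:R] : {ffun T -> R}) :
  [forall y, 0 <= f y] && (\sum_y f y == 1).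
Proof.
apply/andP; split; first by apply/forallP => y; rewrite ffunE ler0n.
rewrite (bigD1 x) //= ffunE eqxx big1 ?addr0 // => y /negbTE yx.
by rewrite ffunE yx.
Qed.

Definition pure (x : T) : mixed := Mixed (pure_subproof x).

End Mixed.

Record stage_game (R : realType) := StageGame {
  nplayers : nat;
  action : 'I_nplayers -> finType;
  action_nonempty : forall i, (0 < #|action i|)%N;
  payoff : 'I_nplayers -> {dffun forall i, action i} -> R }.

Section StageGame.
Variables (R : realType) (G : stage_game R).

Definition player := 'I_(nplayers G).
Definition profile := {dffun forall i : player, action i}.
Definition mixed_profile := forall i : player, mixed R (action i).

Definition deviate (a : profile) (i : player) (b : action i) : profile :=
  [ffun j => @dfwith _ (fun k => action k) a i b j].

Definition mixed_payoff (i : player) (alpha : mixed_profile) : R :=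
  \sum_(a : profile) (\prod_(j : player) alpha j (a j)) * payoff i a.

Definition nash : set mixed_profile :=
  [set alpha | forall (i : player) (beta : mixed R (action i)),
     mixed_payoff i (dfwith alpha i beta) <= mixed_payoff i alpha].

(* The infimum is a minimum, [nash] being nonempty and compact. *)
Definition rNE (i : player) : R := inf [set mixed_payoff i alpha | alpha in nash].

Definition nash_minimiser (i : player) (alpha : mixed_profile) : Prop :=
  nash alpha /\ forall beta, nash beta -> mixed_payoff i alpha <= mixed_payoff i beta.

Definition rcoop (a : nat -> profile) (i : player) (t : nat) : R :=
  payoff i (a t).

Definition rdfct (a : nat -> profile) (i : player) (t : nat) : \bar R :=
  \big[maxe/-oo%E]_(b : action i | b != a t i) (payoff i (deviate (a t) b))%:E.

(* [tail_sum delta t s u] is the sum over tau >= s of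
   delta ^ (tau - t) * u tau; it converges for 0 < delta < 1 and bounded u. *)
Definition tail_sum (delta : R) (t s : nat) (u : nat -> R) : R :=
  limn (fun n => \sum_(s <= tau < n) delta ^+ (tau - t) * u tau).

Definition incentive (delta : R) (a : nat -> profile) (i : player) (t : nat)
    (eps : R) : Prop :=
  ((maxe (rcoop a i t)%:E (rdfct a i t)
    + (tail_sum delta t t.+1 (fun=> rNE i))%:E + eps%:E
    <= (tail_sum delta t t (rcoop a i))%:E))%E.

Definition Astar (delta : R) : set (nat -> profile) :=
  [set a | forall i : player, exists2 eps : R, 0 < eps &
     forall t, incentive delta a i t eps].

(* One period of play: the actions, then who paid the deposit. *)
Definition round := (profile * {ffun player -> bool})%type.

(* Histories of length t are the h : seq round with size h = t. *)
Record strategy (i : player) := Strategy {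
  act_rule : seq round -> mixed R (action i);
  pay_rule : seq round -> profile -> bool }.

Definition strategy_profile := forall i : player, strategy i.

Definition round_prob (s : strategy_profile) (h : seq round) (x : round) : R :=
  (\prod_(j : player) act_rule (s j) h (x.1 j))
  * (x.2 == [ffun j => pay_rule (s j) h x.1])%:R.

Section AugmentedGame.
Variables (delta : R) (T : nat).

Definition deposit_scheme := player -> 'I_T -> R.
Definition terminal_rule := player -> T.-tuple round -> R.

Definition nonneg_deposits (d : deposit_scheme) : Prop :=
  forall i t, 0 <= d i t.

Definition feasible (d : deposit_scheme) (w : terminal_rule) : Prop :=
  forall (i : player) (h : T.-tuple round),
    0 <= w i h <= \sum_(t < T) ((tnth h t).2 i)%:R * d i t.

Definition utility (d : deposit_scheme) (w : terminal_rule) (i : player)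
    (h : T.-tuple round) : R :=
  \sum_(t < T) delta ^+ t
     * (payoff i (tnth h t).1 - ((tnth h t).2 i)%:R * d i t)
  + delta ^+ T.-1 * w i h.

(* Probability of the terminal history hT once h has occurred. *)
Definition history_prob (s : strategy_profile) (h : seq round)
    (hT : T.-tuple round) : R :=
  (take (size h) hT == h)%:R
  * \prod_(t < T | (size h <= t)%N) round_prob s (take t hT) (tnth hT t).

Definition expected_utility (d : deposit_scheme) (w : terminal_rule)
    (s : strategy_profile) (h : seq round) (i : player) : R :=
  \sum_(hT : T.-tuple round) history_prob s h hT * utility d w i hT.

Definition SPE (d : deposit_scheme) (w : terminal_rule)
    (s : strategy_profile) : Prop :=
  forall (i : player) (s' : strategy i) (h : seq round), (size h < T)%N ->
    expected_utility d w (dfwith s i s') h i <= expected_utility d w s h i.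

End AugmentedGame.

Section NashThreats.
Variables (a : nat -> profile) (pun : player -> mixed_profile).

Definition on_path (t : nat) : seq round :=
  mkseq (fun s => (a s, [ffun=> true])) t.

(* The deviators of period t, by stage (actions, then deposits) and within a
   stage by increasing index; repetitions are harmless since only the head of
   the list is used. *)
Definition round_deviators (t : nat) (x : round) : seq player :=
  [seq i <- enum 'I_(nplayers G) | x.1 i != a t i]
  ++ [seq i <- enum 'I_(nplayers G) | ~~ x.2 i].

(* Only meaningful up to and including the first deviation, before which the
   prescribed play is that of [on_path]. *)
Definition first_deviator (h : seq round) : option player :=
  ohead (flatten [seq round_deviators tx.1 tx.2 | tx <- zip (iota 0 (size h)) h]).

Lemma round_deviators_nil (t : nat) (x : round) :
  (round_deviators t x == [::]) = (x == (a t, [ffun=> true])).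
Proof.
case: x => b p; rewrite /round_deviators xpair_eqE /=.
have nilE (P : pred player) :
    ([seq i <- enum 'I_(nplayers G) | P i] == [::]) = [forall i, ~~ P i].
  rewrite -size_eq0 size_filter eqn0Ngt -has_count.
  apply/hasPn/forallP => [nP i|nP i _]; last exact: nP.
  by apply: nP; rewrite mem_enum.
rewrite -size_eq0 size_cat addn_eq0 !size_eq0 !nilE; congr (_ && _).
- by apply/forallP/eqP => [e|-> i]; [apply/ffunP => i; apply/eqP/negPn/e
                                   | rewrite negbK].
- apply/forallP/eqP => [e|-> i]; last by rewrite ffunE.
  by apply/ffunP => i; rewrite ffunE; apply/negPn/e.
Qed.

Lemma first_deviator_None (h : seq round) :
  (first_deviator h == None) = (h == on_path (size h)).
Proof.
rewrite /first_deviator /on_path /mkseq.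
suff E m : (ohead (flatten [seq round_deviators tx.1 tx.2
      | tx <- zip (iota m (size h)) h]) == None) =
    (h == [seq (a s, [ffun=> true]) | s <- iota m (size h)]) by exact: E.
elim: h m => [|x h IH] m //=; rewrite eqseq_cons -IH -round_deviators_nil.
by case: (round_deviators m x).
Qed.

Definition threat_profile : strategy_profile := fun j => {|
  act_rule h := if first_deviator h is Some i then pun i j
                else pure R (a (size h) j);
  pay_rule h x := (h == on_path (size h)) && (x == a (size h)) |}.

End NashThreats.
End StageGame.

(* Main.v *)
(* Every player i pays the constant deposit (1 - delta) eps^i in each period and
   gets everything back at the end exactly when play was on path throughout.
   From any period on, the discounted cost of the remaining deposits is at most
   the margin eps^i, whereas the refund T (1 - delta) eps^i grows linearly in T
   and thus eventually exceeds 2 M / (1 - delta), where |r^i| <= M, a bound on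
   what the truncation to T periods removes from the infinite-horizon incentive
   constraint. Off path nothing is refunded, so no deposit is paid and a stage
   Nash equilibrium is repeated. Optimality against arbitrary, not only one-shot,
   deviations follows by backward induction on the value of the profile after
   each history. *)
Require Import Defs.
From mathcomp Require Import all_boot all_order all_algebra.
From mathcomp Require Import all_classical all_reals all_analysis.
From mathcomp Require Import ring lra.

Set Implicit Arguments.
Unset Strict Implicit.
Unset Printing Implicit Defensive.

Import Order.TTheory GRing.Theory Num.Theory.
Import numFieldNormedType.Exports.
Local Open Scope ring_scope.

(** * Discounted sums and their tails *)

Lemma sumr_geometric (R : comPzRingType) (x : R) (m n : nat) : (m <= n)%N ->
  (1 - x) * (\sum_(m <= k < n) x ^+ k) = x ^+ m - x ^+ n.
Proof.
move=> mn; rewrite mulr_sumr -[RHS]opprB -(telescope_sumr (fun k => x ^+ k) mn).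
by rewrite -sumrN; apply: eq_bigr => k _; rewrite opprB mulrBl mul1r exprS.
Qed.

Lemma ler_norm_discounted_sum (R : realFieldType) (delta M : R) (u : nat -> R)
    (m n : nat) : 0 < delta < 1 -> (forall k, `|u k| <= M) -> (m <= n)%N ->
  `|\sum_(m <= k < n) delta ^+ k * u k| <= M * delta ^+ m / (1 - delta).
Proof.
move=> /andP[d0 d1] uM mn; have d1' : 0 < 1 - delta by rewrite subr_gt0.
have M0 : 0 <= M := le_trans (normr_ge0 _) (uM 0%N).
rewrite ler_pdivlMr // (le_trans (ler_wpM2r (ltW d1') (ler_norm_sum _ _ _))) //.
apply: (@le_trans _ _ ((\sum_(m <= k < n) M * delta ^+ k) * (1 - delta))).
  rewrite ler_wpM2r ?(ltW d1') // ler_sum // => k _.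
  rewrite normrM ger0_norm ?exprn_ge0 ?(ltW d0) // mulrC. by rewrite ler_wpM2r ?exprn_ge0 ?(ltW d0).
rewrite -mulr_sumr -mulrA [_ * (1 - delta)]mulrC sumr_geometric // ler_wpM2l //.
by rewrite gerBl exprn_ge0 ?(ltW d0).
Qed.

(** Comparison with a geometric series. The subtraction [k - t] is truncated, so the factor is 1 for
    [k < t], yet [delta ^+ (k - t)] never exceeds [delta ^+ k / delta ^+ t]. *)
Lemma is_cvg_discounted_sum (R : realType) (delta M : R) (u : nat -> R)
    (t s : nat) : 0 < delta < 1 -> (forall k, `|u k| <= M) ->
  cvgn (fun n => \sum_(s <= k < n) delta ^+ (k - t) * u k).
Proof.
move=> /andP[d0 d1] uM; pose v k := delta ^+ (k - t) * u k.
have M0 : 0 <= M := le_trans (normr_ge0 _) (uM 0%N).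
have cv : cvgn (series v).
  apply: normed_cvg; apply: (@series_le_cvg _ _ (geometric (M / delta ^+ t) delta)).
  - by move=> n /=.
  - by move=> n; rewrite geometric_ge0 ?divr_ge0 ?exprn_ge0 ?(ltW d0).
  - move=> n /=; rewrite normrM ger0_norm ?exprn_ge0 ?(ltW d0) // mulrC -mulrA.
    rewrite ler_pM ?exprn_ge0 ?(ltW d0) // mulrC ler_pdivlMr ?exprn_gt0 // -exprD.
    by rewrite ler_wiXn2l ?(ltW d0) ?(ltW d1) // addnC -leq_subLR.
  - by apply: is_cvg_geometric_series; rewrite ger0_norm ?(ltW d0).
(* For [n] beyond [s], the sum started at [s] is the full partial sum minus a constant. *)
have cw : cvgn (series v \- cst (series v s)) by apply: is_cvgB => //; exact: is_cvg_cst.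
apply: cvgP; apply: cvg_trans cw; apply: near_eq_cvg; near=> n.
have sn : (s <= n)%N by near: n; exact: nbhs_infty_ge.
rewrite /= !seriesEnat /= (@big_cat_nat _ _ _ s) //=. by rewrite addrAC subrr add0r.
Unshelve. all: by end_near.
Qed.

(** The factor [delta ^+ t] discounts to the initial period. A longer partial sum differs from the
    one up to [n] by a block starting at [n], and the geometric bound on that block survives the
    limit. *)
Lemma tail_sum_approx (R : realType) (delta M : R) (u : nat -> R)
    (t s n : nat) : 0 < delta < 1 -> (forall k, `|u k| <= M) ->
  (t <= s <= n)%N ->
  `|delta ^+ t * tail_sum delta t s u - \sum_(s <= k < n) delta ^+ k * u k|
    <= M * delta ^+ n / (1 - delta).
Proof.
move=> d01 uM /andP[ts sn]; have cv := @is_cvg_discounted_sum _ _ _ _ t s d01 uM.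
have cvd : cvgn (fun k => delta ^+ t * \sum_(s <= j < k) delta ^+ (j - t) * u j).
  by apply: is_cvgM => //; exact: is_cvg_cst.
have -> : delta ^+ t * tail_sum delta t s u =
    limn (fun k => delta ^+ t * \sum_(s <= j < k) delta ^+ (j - t) * u j).
  by apply/esym/cvg_lim => //; apply: cvgM => //; exact: cvg_cst.
suff H : \forall k \near \oo%classic,
    `|delta ^+ t * \sum_(s <= j < k) delta ^+ (j - t) * u j
      - \sum_(s <= j < n) delta ^+ j * u j| <= M * delta ^+ n / (1 - delta).
  rewrite ler_distl; apply/andP; split.
    by apply: limr_ge => //; apply: filterS H => k; rewrite ler_distl => /andP[].
  by apply: limr_le => //; apply: filterS H => k; rewrite ler_distl => /andP[].
near=> k; have nk : (n <= k)%N by near: k; exact: nbhs_infty_ge.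
suff -> : delta ^+ t * \sum_(s <= j < k) delta ^+ (j - t) * u j =
    \sum_(s <= j < n) delta ^+ j * u j + \sum_(n <= j < k) delta ^+ j * u j.
  by rewrite addrAC subrr add0r; apply: ler_norm_discounted_sum.
rewrite -big_cat_nat //= mulr_sumr; apply: eq_big_nat => j /andP[sj _].
by rewrite mulrA -exprD subnKC // (leq_trans ts).
Unshelve. all: by end_near.
Qed.

(** * Mixed profiles and expectations over histories *)

Section Game.
Context {R : realType} {G : stage_game R}.
Implicit Types (alpha : mixed_profile G) (i j : player G) (b : profile G).
Implicit Types (s : strategy_profile G) (h : seq (round G)) (T : nat).

Lemma mixed_ge0 (T : finType) (m : mixed R T) (x : T) : 0 <= m x.
Proof. by case: m => f /= /andP[/forallP]. Qed.

Lemma sum_mixed (T : finType) (m : mixed R T) : \sum_x m x = 1.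
Proof. by case: m => f /= /andP[_ /eqP]. Qed.

Definition mixed_prob alpha b : R := \prod_(j : player G) alpha j (b j).

Lemma mixed_prob_ge0 alpha b : 0 <= mixed_prob alpha b.
Proof. by apply: prodr_ge0 => j _; exact: mixed_ge0. Qed.

(** A product of sums expands into a sum over families. Since the action sets vary with the player,
    the families consist of tagged actions, and [untag 0] gives weight zero to a foreign tag. *)
Lemma sum_mixed_prob alpha : \sum_b mixed_prob alpha b = 1.
Proof.
rewrite /mixed_prob (reindex (@dffun_of_fprod _ _)); last first.
  exact/onW_bij/dffun_of_fprod_bij.
transitivity (\sum_(t : fprod (@action R G)) \prod_(j in player G)
    mixed_val (alpha j) (t j)).
  by apply: eq_bigr => t _; apply: eq_bigr => j _; rewrite ffunE.
rewrite big_fprod; pose F (j : player G) (x : {j & action j}) := untag 0 (mixed_val (alpha j)) x.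
rewrite -(bigA_distr_big_dep (fun j => tagged_with (@action R G) j) F) big1 // => j _.
by rewrite -(big_tag (fun j => mixed_val (alpha j)) j) sum_mixed.
Qed.

Lemma mixed_prob_neq0 alpha b j : mixed_prob alpha b != 0 -> alpha j (b j) != 0.
Proof. by move=> /prodf_neq0; apply. Qed.

Definition payoff_bound i : R := \sum_b `|payoff i b|.

Lemma ler_norm_payoff i b : `|payoff i b| <= payoff_bound i.
Proof. by rewrite /payoff_bound (bigD1 b) //= lerDl sumr_ge0. Qed.

Lemma ler_norm_mixed_payoff i alpha : `|mixed_payoff i alpha| <= payoff_bound i.
Proof.
rewrite -[leRHS]mul1r -(sum_mixed_prob alpha) mulr_suml.
rewrite (le_trans (ler_norm_sum _ _ _)) // ler_sum // => b _.
by rewrite normrM ger0_norm ?ler_wpM2l ?ler_norm_payoff ?mixed_prob_ge0.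
Qed.

(** A minimiser supplies both the nonemptiness and the lower bound that make [inf] meaningful. *)
Lemma rNE_minimiser i alpha : nash_minimiser i alpha -> rNE i = mixed_payoff i alpha.
Proof.
move=> [nalpha minalpha]; apply/eqP; rewrite eq_le; apply/andP; split.
  apply: ge_inf; last by exists alpha.
  by exists (mixed_payoff i alpha) => _ [beta nbeta <-]; exact: minalpha.
apply: lb_le_inf; first by exists (mixed_payoff i alpha), alpha.
by move=> _ [beta nbeta <-]; exact: minalpha.
Qed.

(** Payments are a deterministic function of the history and the actions, so a single payment vector
    per action profile carries weight. *)
Lemma sum_round_prob s h (f : round G -> R) :
  \sum_x round_prob s h x * f x =
  \sum_b mixed_prob (fun j => act_rule (s j) h) b
         * f (b, [ffun j => pay_rule (s j) h b]).
Proof.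
transitivity (\sum_b \sum_p round_prob s h (b, p) * f (b, p)).
  by rewrite pair_bigA; apply: eq_bigr => -[].
apply: eq_bigr => b _; rewrite (bigD1 [ffun j => pay_rule (s j) h b]) //=.
rewrite /round_prob eqxx mulr1 [X in _ + X]big1 ?addr0 // => p /negbTE /= ->.
by rewrite mulr0 mul0r.
Qed.

Definition history_mean T s h (f : T.-tuple (round G) -> R) : R :=
  \sum_hT history_prob s h hT * f hT.

(** Conditioning on the next round: a terminal history is compatible with at most one extension of
    [h], the one by its own entry at position [size h]. *)
Lemma history_mean_rcons T s h (f : T.-tuple (round G) -> R) : (size h < T)%N ->
  history_mean s h f = \sum_x round_prob s h x * history_mean s (rcons h x) f.
Proof.
move=> hT; under eq_bigr do rewrite mulr_sumr.
rewrite exchange_big; apply: eq_bigr => /= g _.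
under eq_bigr do rewrite mulrA; rewrite -mulr_suml; congr (_ * _).
pose k := Ordinal hT.
have takeS : take (size h).+1 g = rcons (take (size h) g) (tnth g k).
  by rewrite (tnth_nth (tnth g k)) -take_nth // size_tuple.
rewrite (bigD1 (tnth g k)) //= big1 ?addr0; last first.
  move=> x xk; rewrite /history_prob size_rcons takeS eqseq_rcons.
  by rewrite [tnth g k == x]eq_sym (negbTE xk) andbF mul0r mulr0.
rewrite /history_prob size_rcons takeS eqseq_rcons eqxx andbT.
have [th|] := eqVneq; last by rewrite !mul0r mulr0.
rewrite !mul1r (bigD1 k) //= th; congr (_ * _).
by apply: eq_bigl => t; rewrite ltn_neqAle andbC eq_sym.
Qed.

Lemma history_mean_full T s (h : T.-tuple (round G)) (f : T.-tuple (round G) -> R) :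
  history_mean s h f = f h.
Proof.
rewrite /history_mean (bigD1 h) //= /history_prob size_tuple.
rewrite [X in _ + X]big1 => [|g gh].
  rewrite addr0 take_oversize ?size_tuple // eqxx mul1r big1 ?mul1r // => t.
  by rewrite leqNgt ltn_ord.
rewrite take_oversize ?size_tuple //.
by rewrite -[_ == _]/(g == h) (negbTE gh) !mul0r.
Qed.

Lemma round_prob_ge0 s h x : 0 <= round_prob s h x.
Proof. by rewrite mulr_ge0 ?ler0n // prodr_ge0 // => j _; exact: mixed_ge0. Qed.

(** Backward induction on the number of remaining rounds: a supermartingale that dominates the
    terminal payoff dominates its conditional mean. Arbitrary strategies are thus handled without a
    one-shot deviation principle. *)
Lemma history_mean_le T s (f : T.-tuple (round G) -> R) (V : seq (round G) -> R) :
  (forall hT, f hT <= V hT) ->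
  (forall h, (size h < T)%N -> \sum_x round_prob s h x * V (rcons h x) <= V h) ->
  forall h, (size h <= T)%N -> history_mean s h f <= V h.
Proof.
move=> fV stepV h; move hn : (T - size h)%N => n.
elim: n h hn => [|n IH] h hn hT.
  have {}hT : size h == T by rewrite eqn_leq hT -subn_eq0 hn.
  by rewrite -[h]/(val (Tuple hT)) history_mean_full fV.
have ltT : (size h < T)%N by rewrite -subn_gt0 hn.
rewrite history_mean_rcons // (le_trans _ (stepV _ ltT)) // ler_sum // => x _.
rewrite ler_wpM2l ?round_prob_ge0 // IH ?size_rcons //.
by rewrite subnS hn.
Qed.

(** The martingale case; the reverse inequality is the supermartingale bound for [- f] and [- V]. *)
Lemma history_mean_eq T s (f : T.-tuple (round G) -> R) (V : seq (round G) -> R) :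
  (forall hT, f hT = V hT) ->
  (forall h, (size h < T)%N -> \sum_x round_prob s h x * V (rcons h x) = V h) ->
  forall h, (size h <= T)%N -> history_mean s h f = V h.
Proof.
move=> fV stepV h hT; apply/eqP; rewrite eq_le; apply/andP; split.
  by apply: history_mean_le => // [g|g gT]; rewrite ?fV ?stepV.
rewrite -[leRHS]opprK lerNr -sumrN; under eq_bigr do rewrite -mulrN.
apply: (@history_mean_le T s (fun g => - f g) (fun g => - V g)) => // [g|g gT].
  by rewrite fV.
by under eq_bigr do rewrite mulrN; rewrite sumrN stepV.
Qed.

End Game.

(** * One-round averages and the identity of the first deviator *)

Section OneRound.
Context {R : realType} {G : stage_game R}.
Implicit Types (alpha : mixed_profile G) (i j : player G) (b : profile G).

Lemma mixed_mean_le alpha (f : profile G -> R) (v : R) :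
  (forall b, mixed_prob alpha b != 0 -> f b <= v) ->
  \sum_b mixed_prob alpha b * f b <= v.
Proof.
move=> fv; rewrite -[leRHS]mul1r -(sum_mixed_prob alpha) mulr_suml ler_sum // => b _.
have [->|/fv] := eqVneq (mixed_prob alpha b) 0; first by rewrite !mul0r.
by apply: ler_wpM2l; exact: mixed_prob_ge0.
Qed.

Lemma mixed_mean_eq alpha (f : profile G -> R) (v : R) :
  (forall b, mixed_prob alpha b != 0 -> f b = v) ->
  \sum_b mixed_prob alpha b * f b = v.
Proof.
move=> fv; rewrite -[RHS]mul1r -(sum_mixed_prob alpha) mulr_suml.
apply: eq_bigr => b _; have [->|/fv-> //] := eqVneq (mixed_prob alpha b) 0.
by rewrite !mul0r.
Qed.

Lemma mixed_mean_payoff alpha i (x y : R) :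
  \sum_b mixed_prob alpha b * (x + y * payoff i b) = x + y * mixed_payoff i alpha.
Proof.
under eq_bigr do rewrite mulrDr mulrCA.
rewrite big_split /= -mulr_suml sum_mixed_prob mul1r; congr (_ + _).
by rewrite /mixed_payoff mulr_sumr.
Qed.

Lemma pure_neq0 (A : finType) (x y : A) : pure R x y != 0 -> y = x.
Proof. by rewrite /= ffunE; have [|_] := eqVneq y x; rewrite ?eqxx. Qed.

Lemma profile_neq b (c : profile G) i : (forall j, j != i -> b j = c j) -> b != c -> b i != c i.
Proof.
move=> bc; apply: contra => /eqP bci; apply/eqP/ffunP => j.
by have [->|/bc] := eqVneq j i.
Qed.

Lemma first_deviator_rcons (a : nat -> profile G) h (x : round G) :
  first_deviator a (rcons h x) = if first_deviator a h is Some j then Some j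
    else ohead (round_deviators a (size h) x).
Proof.
rewrite /first_deviator size_rcons -addn1 iotaD add0n cats1.
rewrite zip_rcons ?size_iota // map_rcons flatten_rcons.
by case: (flatten _).
Qed.

(** If the actions are on target, the others all pay and only [i] can be listed. Otherwise the
    others rightly withhold and so may appear in the deposit part of the list, but [i] stands before
    them in the action part. *)
Lemma ohead_round_deviators (a : nat -> profile G) t i (x : round G) :
  (forall j, j != i -> x.1 j = a t j) ->
  (forall j, j != i -> x.2 j = (x.1 == a t)) ->
  ohead (round_deviators a t x) =
    if x == (a t, [ffun=> true]) then None else Some i.
Proof.
rewrite -round_deviators_nil => ax px.
case E: (round_deviators a t x) => [//|j s] /=; congr Some; apply/eqP.
have: j \in round_deviators a t x by rewrite E mem_head.
apply: contraLR => ji; rewrite mem_cat !mem_filter (ax _ ji) eqxx /= (px _ ji).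
rewrite andbC negb_and negbK; apply/orP; right; apply: contraT => xa.
move: E; rewrite /round_deviators.
case F: [seq k <- _ | _] => [|k s'] /=; last first.
  have: k \in [seq k <- enum 'I_(nplayers G) | x.1 k != a t k] by rewrite F mem_head.
  rewrite mem_filter => /andP[ak _] [kj _]; subst k.
  by rewrite (ax _ ji) eqxx in ak.
have: i \in [seq k <- enum 'I_(nplayers G) | x.1 k != a t k].
  by rewrite mem_filter mem_enum profile_neq.
by rewrite F.
Qed.

Lemma mixed_payoff_ext i alpha beta : (forall j, alpha j = beta j) ->
  mixed_payoff i alpha = mixed_payoff i beta.
Proof.
by move=> e; apply: eq_bigr => b _; congr (_ * _); apply: eq_bigr => j _; rewrite e.
Qed.

End OneRound.

(** * The value of the threat profile and its optimality *)

Section ThreatProfile.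
Context {R : realType} {G : stage_game R}.
Variables (delta : R) (D : player G -> R) (T : nat).
Variables (a : nat -> profile G) (pun : player G -> mixed_profile G).
Implicit Types (i j : player G) (b : profile G) (h : seq (round G)).

Definition constant_deposits : deposit_scheme G T := fun i _ => D i.

Definition on_path_refund : terminal_rule G T := fun i hT =>
  if first_deviator a hT is None then T%:R * D i else 0.

(** On path the refund is exactly the undiscounted total of the deposits paid, so the bound is tight
    there. *)
Lemma on_path_refund_feasible : (forall i, 0 <= D i) ->
  feasible constant_deposits on_path_refund.
Proof.
move=> D0 i h; rewrite /on_path_refund /constant_deposits.
case E: (first_deviator a h) => [j|].
  by rewrite lexx sumr_ge0 // => t _; rewrite mulr_ge0.
rewrite mulr_ge0 //=; move/eqP: E; rewrite first_deviator_None size_tuple => /eqP hE.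
rewrite (eq_bigr (fun=> D i)) => [|t _].
  by rewrite sumr_const card_ord mulr_natl.
by rewrite (tnth_nth (a 0%N, [ffun=> true])) hE nth_mkseq // ffunE mul1r.
Qed.

Definition accrued i h : R :=
  \sum_(k < size h) delta ^+ k * (payoff i (nth (a 0%N, [ffun=> true]) h k).1
    - ((nth (a 0%N, [ffun=> true]) h k).2 i)%:R * D i).

Lemma accrued_rcons i h (x : round G) : accrued i (rcons h x) =
  accrued i h + delta ^+ size h * (payoff i x.1 - (x.2 i)%:R * D i).
Proof.
rewrite /accrued size_rcons big_ord_recr /= nth_rcons ltnn eqxx; congr (_ + _).
by apply: eq_bigr => k _; rewrite nth_rcons ltn_ord.
Qed.

(** As in [punished_value], amounts are discounted to the initial period rather than to period [t],
    so that they add directly to [accrued]. *)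
Definition coop_value i (t : nat) : R :=
  \sum_(t <= k < T) delta ^+ k * (payoff i (a k) - D i)
  + delta ^+ T.-1 * (T%:R * D i).

Definition punished_value j i (t : nat) : R :=
  \sum_(t <= k < T) delta ^+ k * mixed_payoff i (pun j).

(** The function used for backward induction: a martingale under the threat profile, and a
    supermartingale when [i] alone changes strategy. *)
Definition value i h : R := accrued i h +
  if first_deviator a h is Some j then punished_value j i (size h)
  else coop_value i (size h).

Lemma utility_value i (hT : T.-tuple (round G)) :
  utility delta constant_deposits on_path_refund i hT = value i hT.
Proof.
rewrite /utility /value /accrued /on_path_refund !size_tuple.
rewrite /coop_value /punished_value big_geq // add0r; congr (_ + _).
  by apply: eq_bigr => t _; rewrite !(tnth_nth (a 0%N, [ffun=> true])).
by case: (first_deviator a hT) => [j|]; rewrite ?big_geq ?mulr0.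
Qed.

Hypothesis delta_ge0 : 0 <= delta.
Hypothesis D_ge0 : forall i, 0 <= D i.
Hypothesis pun_nash : forall i, nash (pun i).
(** The case [b = a t] covers withholding the deposit alone. No current deposit appears on the left,
    since a deviator does best by not paying. *)
Hypothesis sustain : forall i t b, (t < T)%N ->
  (forall j, j != i -> b j = a t j) ->
  delta ^+ t * payoff i b + punished_value i i t.+1 <= coop_value i t.

(** The right side is affine in [payoff i x.1], ready for [mixed_mean_payoff], with the wasted
    deposit split off as a loss. *)
Lemma value_rcons_deviated i j h (x : round G) : (size h < T)%N ->
  first_deviator a h = Some j ->
  value i (rcons h x) = accrued i h + punished_value j i (size h).+1
    + delta ^+ size h * payoff i x.1 - delta ^+ size h * ((x.2 i)%:R * D i).
Proof.
move=> hT hj; rewrite /value first_deviator_rcons hj accrued_rcons size_rcons.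
by rewrite mulrBr addrAC -!addrA; congr (_ + _); rewrite addrA addrC.
Qed.

Lemma value_deviated i j h : (size h < T)%N -> first_deviator a h = Some j ->
  accrued i h + punished_value j i (size h).+1
    + delta ^+ size h * mixed_payoff i (pun j) = value i h.
Proof.
move=> hT hj; rewrite /value hj -addrA /punished_value; congr (_ + _).
by rewrite addrC [RHS]big_ltn.
Qed.

Lemma coop_value_ltn i t : (t < T)%N ->
  delta ^+ t * (payoff i (a t) - D i) + coop_value i t.+1 = coop_value i t.
Proof. by move=> tT; rewrite /coop_value [in RHS]big_ltn // addrA. Qed.

Lemma value_rcons_on_path i h (x : round G) : (size h < T)%N ->
  first_deviator a h = None -> x = (a (size h), [ffun=> true]) ->
  value i (rcons h x) = value i h.
Proof.
move=> hT hN xE; rewrite /value accrued_rcons first_deviator_rcons hN size_rcons.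
have /eqP-> : round_deviators a (size h) x == [::] by rewrite round_deviators_nil xE.
by rewrite /= xE /= ffunE mul1r -addrA coop_value_ltn.
Qed.

(** As the others follow their rules, leaving the path makes [i] the first deviator. A deposit paid
    in that round is lost, so dropping it bounds the value by the left side of [sustain]. *)
Lemma value_rcons_leaving i h (x : round G) : (size h < T)%N ->
  first_deviator a h = None ->
  (forall j, j != i -> x.1 j = a (size h) j) ->
  (forall j, j != i -> x.2 j = (x.1 == a (size h))) ->
  value i (rcons h x) <= value i h.
Proof.
move=> hT hN ax px; have [xE|xE] := eqVneq x (a (size h), [ffun=> true]).
  by rewrite value_rcons_on_path.
rewrite /value accrued_rcons first_deviator_rcons hN size_rcons.
rewrite (ohead_round_deviators ax px) (negbTE xE) -addrA lerD2l.
apply: le_trans (sustain hT ax); rewrite lerD2r ler_wpM2l ?exprn_ge0 //.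
by rewrite gerBl mulr_ge0.
Qed.

Let threat := threat_profile a pun.

Lemma act_rule_on_path j h : first_deviator a h = None ->
  act_rule (threat j) h = pure R (a (size h) j).
Proof. by move=> /= ->. Qed.

Lemma step_threat i h : (size h < T)%N ->
  \sum_x round_prob threat h x * value i (rcons h x) = value i h.
Proof.
move=> hT; rewrite sum_round_prob.
case E: (first_deviator a h) => [j|].
  have hn : h == on_path a (size h) = false by rewrite -first_deviator_None E.
  rewrite -(value_deviated i hT E) -mixed_mean_payoff.
  apply: eq_bigr => b _; rewrite (value_rcons_deviated _ _ hT E) /= ffunE hn /=.
  rewrite mul0r mulr0 subr0; congr (_ * _).
  by apply: eq_bigr => k _; rewrite /= E.
have hn : h == on_path a (size h) by rewrite -first_deviator_None E.
(* All action rules are pure on path, so positive probability forces the target profile. *)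
apply: mixed_mean_eq => b bP.
have ba : b = a (size h).
  apply/ffunP => j; apply: (@pure_neq0 R).
  by have := mixed_prob_neq0 j bP; rewrite act_rule_on_path.
apply: value_rcons_on_path => //; rewrite ba; congr (_, _).
by apply/ffunP => j; rewrite !ffunE /= hn eqxx.
Qed.

Lemma step_deviation i (s' : strategy i) h : (size h < T)%N ->
  \sum_x round_prob (dfwith threat i s') h x * value i (rcons h x) <= value i h.
Proof.
move=> hT; rewrite sum_round_prob.
case E: (first_deviator a h) => [j|].
  rewrite -(value_deviated i hT E).
  apply: (@le_trans _ _ (accrued i h + punished_value j i (size h).+1
      + delta ^+ size h * mixed_payoff i (dfwith (pun j) i (act_rule s' h)))).
    rewrite (@mixed_payoff_ext _ _ _ _
      (fun k => act_rule (dfwith threat i s' k) h)); last first.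
      by move=> k; case: dfwithP => [|k' ik]; rewrite ?dfwithin ?dfwithout //= E.
    rewrite -mixed_mean_payoff ler_sum // => b _.
    rewrite (value_rcons_deviated _ _ hT E) ler_wpM2l ?mixed_prob_ge0 //=.
    by rewrite gerBl !mulr_ge0 ?exprn_ge0.
  by rewrite lerD2l ler_wpM2l ?exprn_ge0 //; exact: pun_nash.
have hn : h == on_path a (size h) by rewrite -first_deviator_None E.
(* On path the others act purely, so with positive probability a round departs from their prescribed
   play only through [i]. *)
apply: mixed_mean_le => b bP; apply: value_rcons_leaving => //= j ji.
  apply: (@pure_neq0 R); have := mixed_prob_neq0 j bP.
  by rewrite dfwithout ?act_rule_on_path // eq_sym.
by rewrite ffunE dfwithout /= ?hn // eq_sym.
Qed.

Lemma SPE_threat : SPE delta constant_deposits on_path_refund threat.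
Proof.
move=> i s' h hT; rewrite /expected_utility.
have := history_mean_eq (@utility_value i) (@step_threat i) (ltnW hT).
rewrite /history_mean => ->.
apply: history_mean_le (@step_deviation i s') _ (ltnW hT) => g.
by rewrite utility_value.
Qed.

End ThreatProfile.

(** * From the infinite-horizon incentive to a finite horizon *)

Section Sustainability.
Context {R : realType} {G : stage_game R}.
Variables (delta : R) (eps : R) (T : nat) (a : nat -> profile G).
Variables (i : player G) (alpha : mixed_profile G).
Hypothesis delta01 : 0 < delta < 1.
Hypothesis alpha_min : nash_minimiser i alpha.

(** The maximum in [incentive] treats compliance and deviation together: [b] is either the target or
    one of the profiles over which [rdfct] is taken. *)
Lemma incentive_payoff (t : nat) (b : profile G) :
  incentive delta a i t eps -> (forall j, j != i -> b j = a t j) ->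
  payoff i b + tail_sum delta t t.+1 (fun=> rNE i) + eps
    <= tail_sum delta t t (rcoop a i).
Proof.
move=> inc ab; rewrite -lee_fin; apply: le_trans inc; rewrite 2!EFinD.
apply: leeD => //; apply: leeD => //; rewrite le_max.
have [->|/(profile_neq ab) bi] := eqVneq b (a t); first by rewrite lexx.
apply/orP; right.
suff {1}-> : b = deviate (a t) (b i).
  exact: (le_bigmax_cond -oo%E (fun c => (payoff i (deviate (a t) c))%:E) bi).
apply/ffunP => j; rewrite ffunE; case: dfwithP => // j' ij.
by rewrite ab // eq_sym.
Qed.

Lemma incentive_sustain (t : nat) (b : profile G) :
  0 <= eps ->
  2 * payoff_bound i <= T%:R * (1 - delta) ^+ 2 * eps ->
  incentive delta a i t eps -> (t < T)%N -> (forall j, j != i -> b j = a t j) ->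
  delta ^+ t * payoff i b + \sum_(t.+1 <= k < T) delta ^+ k * mixed_payoff i alpha
    <= \sum_(t <= k < T) delta ^+ k * (payoff i (a k) - (1 - delta) * eps)
       + delta ^+ T.-1 * (T%:R * ((1 - delta) * eps)).
Proof.
move=> eps0 Tbig inc tT ab; have /andP[d0 d1] := delta01.
set M := payoff_bound i; have d1' : 0 < 1 - delta by rewrite subr_gt0.
have coopM k : `|rcoop a i k| <= M by exact: ler_norm_payoff.
have neM (k : nat) : `|rNE i| <= M.
  by rewrite (rNE_minimiser alpha_min) ler_norm_mixed_payoff.
have := @tail_sum_approx _ _ _ _ t t T delta01 coopM.
rewrite leqnn (ltnW tT) => /(_ isT); rewrite ler_distl => /andP[_ coop_le].
have := @tail_sum_approx _ _ _ _ t t.+1 T delta01 neM.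
rewrite leqnSn tT => /(_ isT); rewrite ler_distl => /andP[ne_ge _].
have := ler_wpM2l (exprn_ge0 t (ltW d0)) (incentive_payoff inc ab).
rewrite !mulrDr => dev_le.
(* The factor [1 - delta] in the deposit cancels the denominator of the geometric sum, leaving at
   most the margin. *)
have sum_dep : \sum_(t <= k < T) delta ^+ k * ((1 - delta) * eps)
    <= delta ^+ t * eps.
  rewrite -mulr_suml mulrA [_ * (1 - delta)]mulrC sumr_geometric ?(ltnW tT) //.
  by rewrite ler_wpM2r // gerBl exprn_ge0 // ltW.
(* The factor 2 counts two truncation errors, one for the cooperative sum and one for the punishment
   sum. *)
have refund : 2 * (M * delta ^+ T / (1 - delta))
    <= delta ^+ T.-1 * (T%:R * ((1 - delta) * eps)).
  apply: (@le_trans _ _ (delta ^+ T * (2 * M / (1 - delta)))).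
    by rewrite le_eqVlt; apply/orP; left; apply/eqP; ring.
  apply: ler_pM; rewrite ?exprn_ge0 ?(ltW d0) //.
  - by rewrite divr_ge0 ?(ltW d1') // mulr_ge0 // (le_trans (normr_ge0 _) (neM 0%N)).
  (* Since [t < T], [T] is positive and [delta ^+ T] is [delta] times [delta ^+ T.-1]. *)
  - by rewrite -[in leLHS](ltn_predK tT) exprS ger_pMl ?exprn_gt0 // ltW.
  (* Of the two factors [1 - delta] in [Tbig], one comes from the geometric tail and one from the
     size of the deposit. *)
  rewrite ler_pdivrMr // (le_trans Tbig) // le_eqVlt; apply/orP; left.
  by apply/eqP; ring.
(* The rest is linear: [dev_le], [coop_le], [ne_ge], [sum_dep] and [refund] add up to the goal. *)
rewrite -(rNE_minimiser alpha_min).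
under [X in _ <= X + _]eq_bigr do rewrite mulrBr.
rewrite sumrB; clear neM; rewrite /rcoop in coop_le dev_le; lra.
Qed.

End Sustainability.

Theorem theorem3 (R : realType) (G : stage_game R) (delta : R)
    (eps : player G -> R) :
  0 < delta < 1 ->
  (forall i, 0 < eps i) ->
  exists Tstar : nat,
    forall a : nat -> profile G,
      Astar delta a ->
      (forall (i : player G) (t : nat), incentive delta a i t (eps i)) ->
      forall pun : player G -> mixed_profile G,
        (forall i, nash_minimiser i (pun i)) ->
        forall T : nat, (Tstar <= T)%N ->
          exists (d : deposit_scheme G T) (w : terminal_rule G T),
            [/\ nonneg_deposits d,
                feasible d w
              & SPE delta d w (threat_profile a pun)].
Proof.
move=> d01 eps0; have /andP[d0 d1] := d01.
have d1' : 0 < 1 - delta by rewrite subr_gt0.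
(* The bound on the horizon obtained by solving the inequality required in [incentive_sustain] for
   [T]. *)
pose need i := 2 * payoff_bound i / ((1 - delta) ^+ 2 * eps i).
have need_gt0 i : 0 < (1 - delta) ^+ 2 * eps i by rewrite mulr_gt0 ?exprn_gt0.
have need_ge0 i : 0 <= need i.
  by rewrite divr_ge0 ?(ltW (need_gt0 i)) // mulr_ge0 // sumr_ge0.
(* The threshold is fixed before [a] and [pun]; the maximum over the finitely many players serves
   all of them at once. *)
exists (\max_i Num.bound (need i)) => a _ inc pun pun_min T Tbig.
pose D i := (1 - delta) * eps i.
have D0 i : 0 <= D i by rewrite mulr_ge0 ?ltW.
exists (constant_deposits D (T := T)), (on_path_refund D a (T := T)); split.
- by move=> i t; exact: D0.
- exact: on_path_refund_feasible.
apply: SPE_threat => [|//|i|i t b tT ab]; first exact: ltW.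
  by have [] := pun_min i.
apply: (incentive_sustain d01 (pun_min i) (ltW (eps0 i))) (inc i t) tT ab.
rewrite -mulrA -ler_pdivrMr // (le_trans (ltW (archi_boundP (need_ge0 i)))) //.
by rewrite ler_nat (leq_trans _ Tbig) // (leq_bigmax i).
Qed.
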